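(* Let $n,k\ge1$ and let $w$ be whirling on $\mathcal{F}_k({\sf C}_n)$. For any $f\in\mathcal{F}_k({\sf C}_n)$, with $A=A(f)$ and $\alpha=\#A(f)$, we have $w^{k+2}f=\overline{w}_{A(f)}f$. Consequently $w^{\alpha(k+2)}f=f$.
   Context: The claw poset ${\sf C}_n=\{b_1,\dots,b_n,\widehat0\}$ has relations $\widehat0<b_i$ for all $i$ and no others. $\mathcal{F}_k({\sf C}_n)$ is the set of functions $f:{\sf C}_n\to\{0,\dots,k\}$ with $f(b_i)\le f(\widehat0)$ for all $i$. For $x\in{\sf C}_n$, the whirl $w_x$ repeatedly adds $1$ modulo $k+1$ to $f(x)$ (other values unchanged) until the result lies in $\mathcal{F}_k({\sf C}_n)$; whirling is $w=w_{\widehat0}\circ w_{b_n}\circ\cdots\circ w_{b_1}$ (the $w_{b_i}$ commute). For $f\in\mathcal{F}_k({\sf C}_n)$, $A(f)=\{f(b_j):j\in[n]\}$. For a subset $A\subseteq\{0,\dots,k\}$ and $g\in\mathcal{F}_k({\sf C}_n)$ with all $g(b_j)\in A$, $\overline{w}_A(g)$ is the function that agrees with $g$ at $\widehat0$ and sends each $b_j$ to the cyclic successor of $g(b_j)$ within $A$ (the next larger element of $A$, with the largest element of $A$ going to the smallest). *)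

(* Defs.v *)
From HB Require Import structures.
From mathcomp Require Import all_boot.

Set Implicit Arguments.
Unset Strict Implicit.
Unset Printing Implicit Defensive.

Definition claw (n : nat) := option 'I_n.
HB.instance Definition _ n := Finite.on (claw n).

(* [leg i] is the paper's b_(i+1). *)
Definition hat0 {n} : claw n := None.
Definition leg {n} (i : 'I_n) : claw n := Some i.

Section Whirling.

Variables n k : nat.

Definition labeling := {ffun claw n -> 'I_k.+1}.
HB.instance Definition _ := Finite.on labeling.

Implicit Types (f g : labeling) (x : claw n) (A : {set 'I_k.+1}).

Definition Fk : {set labeling} :=
  [set f : labeling | [forall i : 'I_n, f (leg i) <= f hat0]].

(* [ordS] is addition of 1 modulo k+1 on 'I_k.+1. *)
Definition incr_at x f : labeling :=
  [ffun y => if y == x then ordS (f y) else f y].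

(* Increments at least once, and stops at the first result lying in Fk. *)
Fixpoint whirl_loop (fuel : nat) x f : labeling :=
  let g := incr_at x f in
  if g \in Fk then g
  else if fuel is fuel'.+1 then whirl_loop fuel' x g else g.

(* [k] iterations after the first are enough: k+1 increments give back f, so
   the bound is never what stops the loop when f \in Fk (see [whirl_at_Fk]). *)
Definition whirl_at x f : labeling := whirl_loop k x f.

(* [foldl] over [enum 'I_n] applies the whirl at b_1 first and at b_n last. *)
Definition whirl f : labeling :=
  whirl_at hat0 (foldl (fun g i => whirl_at (leg i) g) f (enum 'I_n)).

Definition Aset f : {set 'I_k.+1} := [set f (leg j) | j : 'I_n].

(* [enum A] lists A in increasing order, and [next] is the successor in that
   list read cyclically (see [cyc_succP]). *)
Definition cyc_succ A (a : 'I_k.+1) : 'I_k.+1 := next (enum A) a.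

Definition wbar A g : labeling :=
  [ffun y => if y is Some j then cyc_succ A (g (leg j)) else g hat0].

Lemma iter_incr_at m x f y :
  val (iter m (incr_at x) f y) = if y == x then (f y + m) %% k.+1 else f y.
Proof.
elim: m => [|m IHm] /=; first by rewrite addn0 modn_small ?ltn_ord ?if_same.
rewrite ffunE; case: ifP IHm => //= _ ->.
by rewrite -addn1 modnDml addn1 addnS.
Qed.

Lemma whirl_loop_iter fuel x f :
  exists2 m, m <= fuel & whirl_loop fuel x f = iter m.+1 (incr_at x) f /\
    (forall j, j < m -> iter j.+1 (incr_at x) f \notin Fk) /\
    ((iter m.+1 (incr_at x) f \in Fk) \/ m = fuel).
Proof.
elim: fuel f => [|fuel IH] f /=.
  by exists 0; rewrite // if_same; split=> //; split=> //; right.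
case: ifPn => [Fg|nFg]; first by exists 0 => //; split=> //; split=> //; left.
have [m lem [-> [min_m stop]]] := IH (incr_at x f).
exists m.+1 => //; rewrite -iterSr; split=> //; split; last first.
  by case: stop => [?|->]; [left; rewrite iterSr|right].
by case=> [|j] ltj //; rewrite iterSr; apply: min_m.
Qed.

Lemma whirl_at_Fk x f : f \in Fk ->
  exists m, [/\ whirl_at x f = iter m.+1 (incr_at x) f,
                whirl_at x f \in Fk
              & forall j, j < m -> iter j.+1 (incr_at x) f \notin Fk].
Proof.
move=> Ff; have [m _ [eq_m [min_m stop]]] := whirl_loop_iter k x f.
exists m; split=> //; rewrite /whirl_at eq_m.
case: stop => // ->; suff -> : iter k.+1 (incr_at x) f = f by [].
apply/ffunP => y; apply: val_inj; rewrite iter_incr_at modnDr modn_small //.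
exact: if_same.
Qed.

Lemma whirl_Fk f : f \in Fk -> whirl f \in Fk.
Proof.
move=> Ff; rewrite /whirl.
have wF x g : g \in Fk -> whirl_at x g \in Fk by move/(whirl_at_Fk x) => [m []].
by apply: (wF); elim: (enum _) f Ff => //= i s IHs g Fg; apply/IHs/wF.
Qed.

Lemma cyc_succ_in A a : a \in A -> cyc_succ A a \in A.
Proof. by rewrite -!(mem_enum A) mem_next. Qed.

Lemma enum_sorted A : sorted (relpre val ltn) (enum A).
Proof.
have ltn_t : transitive (relpre (val : 'I_k.+1 -> nat) ltn).
  by move=> y x z; apply: ltn_trans.
have -> : enum A = filter (mem A) (enum 'I_k.+1).
  by rewrite {1}/enum_mem enumT.
by apply: sorted_filter => //; rewrite -sorted_map val_enum_ord iota_ltn_sorted.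
Qed.

Lemma cyc_succP A a : a \in A ->
  if [exists b in A, a < b]
  then a < cyc_succ A a /\ (forall b, b \in A -> a < b -> cyc_succ A a <= b)
  else forall b, b \in A -> cyc_succ A a <= b.
Proof.
move=> Aa; rewrite /cyc_succ next_nth mem_enum Aa.
have := enum_sorted A; have ins b : (b \in A) = (b \in enum A) by rewrite mem_enum.
have {Aa} := Aa; rewrite ins.
have ltn_t : transitive (relpre (val : 'I_k.+1 -> nat) ltn).
  by move=> y x z; apply: ltn_trans.
case E: (enum A) => [//|y p] ina srt; set i := index a (y :: p).
have lti : i < size (y :: p) by rewrite index_mem.
have ai : nth y (y :: p) i = a by rewrite nth_index.
have mono u v : u < size (y :: p) -> v < size (y :: p) -> u < v ->
    nth y (y :: p) u < nth y (y :: p) v.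
  by move=> hu hv; apply: (sorted_ltn_nth ltn_t).
have monoW u v : u < size (y :: p) -> v < size (y :: p) -> u <= v ->
    nth y (y :: p) u <= nth y (y :: p) v.
  by move=> hu hv; rewrite leq_eqVlt => /predU1P[-> //|/(mono u v hu hv)/ltnW].
case: existsP => [[b /andP[Ab ltab]]|nex].
  have bnd c : c \in A -> a < c -> i < index c (y :: p) < size (y :: p).
    move=> Ac ltac; rewrite index_mem -E -ins Ac andbT E ltnNge.
    apply/negP => le_ci; have := monoW _ _ (leq_ltn_trans le_ci lti) lti le_ci.
    by rewrite ai nth_index -?E -?ins // leqNgt ltac.
  have /andP[ltib ltbs] := bnd b Ab ltab.
  have lti1 : i.+1 < size (y :: p) by apply: leq_ltn_trans ltbs.
  split; first by rewrite -{1}ai; apply: (mono i i.+1).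
  move=> c Ac /(bnd c Ac)/andP[ltic ltcs].
  by rewrite -[in leqRHS](nth_index y (_ : c \in y :: p)) -?E -?ins // E;
    apply: (monoW i.+1).
have ge_p : size p <= i.
  rewrite leqNgt; apply/negP => ltip; case: nex; exists (nth y (y :: p) i.+1).
  by rewrite ins E mem_nth // -{1}ai mono.
move=> b Ab; rewrite nth_default //.
have inb : b \in y :: p by rewrite -E -ins.
by rewrite -(nth_index y inb); apply: (monoW 0); rewrite ?index_mem.
Qed.

End Whirling.

Arguments Fk : clear implicits.

(* Main.v *)
(** Write h for the value at the minimum of the claw. Whirling sends a leg value
    v to v + 1 if v < h and to 0 if v = h; then h becomes h + 1 if h < k, and the
    largest leg value if h = k. Place on the circle Z/(k+2) the distinct leg
    values together with one marker, at h if all legs are below h and at k + 1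
    otherwise. Each whirl rotates all these points by one; whenever the marker
    wraps to 0 it exchanges places with the largest leg value. So in the rotating
    frame the marker moves back by one point each time, which makes every point
    wrap exactly once, with the marker on it, during k + 2 whirls. After these
    the points and the marker are back in place, and every leg has moved to the
    next larger leg value, cyclically. *)

Require Import Defs.
From mathcomp Require Import all_boot.
From mathcomp Require Import zify.

Definition is_max {I : Type} (v : I -> nat) (m : nat) :=
  (forall i, v i <= m) /\ exists i, v i = m.

(** * One whirl in terms of natural numbers *)

Section WhirlAt.

Variables n k : nat.
Implicit Types f g : labeling n k.

Lemma FkP f : reflect (forall i, f (leg i) <= f hat0) (f \in Fk n k).
Proof. by rewrite inE; apply: forallP. Qed.

Lemma whirl_at_in_Fk x f : f \in Fk n k -> whirl_at x f \in Fk n k.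
Proof. by case/(whirl_at_Fk x) => m []. Qed.

(** Both counts describe the first return to [Fk], so they agree, and the loop need not be unfolded
    again. *)
Lemma whirl_at_first x f d : f \in Fk n k ->
    iter d.+1 (incr_at x) f \in Fk n k ->
    (forall j, j < d -> iter j.+1 (incr_at x) f \notin Fk n k) ->
  whirl_at x f = iter d.+1 (incr_at x) f.
Proof.
move=> Ff Fd min_d; have [m [-> Fm min_m]] := whirl_at_Fk x Ff.
case: (ltngtP m d) => [/min_d/negP[]|/min_m/negP[]|->] //.
Qed.

Lemma whirl_at_leg f i : f \in Fk n k ->
  [/\ whirl_at (leg i) f (leg i) =
        (if f (leg i) < f hat0 then (f (leg i)).+1 else 0) :> nat
    & forall y, y != leg i -> whirl_at (leg i) f y = f y].
Proof.
move=> Ff; have /FkP le_f := Ff.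
have lth := ltn_ord (f hat0); have ltf := ltn_ord (f (leg i)).
have valE m y : iter m (incr_at (leg i)) f y =
    (if y == leg i then (f y + m) %% k.+1 else f y) :> nat.
  exact: iter_incr_at.
have Fi m : (iter m (incr_at (leg i)) f \in Fk n k) =
    ((f (leg i) + m) %% k.+1 <= f hat0).
  apply/FkP/idP => [/(_ i)|le_m j]; rewrite !valE ?eqxx //.
  by case: eqP => [[->]|_].
have other m y : y != leg i -> iter m (incr_at (leg i)) f y = f y.
  by move=> /negPf neq; apply: val_inj; rewrite /= valE neq.
case: ltnP => [ltfh|].
  rewrite (@whirl_at_first _ _ 0) //; last by rewrite Fi addn1 modn_small; lia.
  by split; [rewrite valE eqxx addn1 modn_small; lia|apply: other].
have := le_f i => le1 le2.
have eq_fh : f (leg i) = f hat0 :> nat by lia.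
(* A leg equal to the header passes through the inadmissible values above [f hat0] up to [k], then
   wraps to 0. *)
have wE : (f (leg i) + (k - f hat0).+1) %% k.+1 = 0.
  by rewrite eq_fh addnS subnKC // modnn.
rewrite (@whirl_at_first _ _ (k - f hat0)) //.
- by split; [rewrite valE eqxx wE|apply: other].
- by rewrite Fi wE.
by move=> j ltj; rewrite Fi -ltnNge modn_small; lia.
Qed.

Lemma whirl_at_hat0 f : 0 < n -> f \in Fk n k ->
  [/\ forall i, whirl_at hat0 f (leg i) = f (leg i),
      f hat0 < k -> whirl_at hat0 f hat0 = (f hat0).+1 :> nat
    & k <= f hat0 ->
      is_max (fun i => val (f (leg i))) (whirl_at hat0 f hat0)].
Proof.
move=> n_gt0 Ff; have /FkP le_f := Ff; have lth := ltn_ord (f hat0).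
have valE m y : iter m (incr_at hat0) f y =
    (if y == hat0 then (f y + m) %% k.+1 else f y) :> nat.
  exact: iter_incr_at.
split=> [i|ltfk|lekf].
- have [m [-> _ _]] := whirl_at_Fk hat0 Ff.
  by apply: ord_inj; rewrite valE.
- rewrite (@whirl_at_first _ _ 0) //; first by rewrite valE eqxx addn1 modn_small; lia.
  by apply/FkP => i; rewrite !valE eqxx /= addn1 modn_small; have := le_f i; lia.
pose i0 := [arg max_(i > Ordinal n_gt0) val (f (leg i))].
have max_i0 i : f (leg i) <= f (leg i0).
  by rewrite /i0; case: arg_maxnP => //= j _; apply.
have hE m : m <= k -> (f hat0 + m.+1) %% k.+1 = m.
  move=> lemk; have -> : f hat0 + m.+1 = m + k.+1 by lia.
  by rewrite modnDr modn_small.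
have lti0 := ltn_ord (f (leg i0)).
have wE : whirl_at hat0 f hat0 = f (leg i0) :> nat.
  (* From [k] the header runs through 0, 1, ...; the first value bounding every leg is the largest
     leg value. *)
  rewrite (@whirl_at_first _ _ (f (leg i0))) //.
  - by rewrite valE eqxx hE.
  - by apply/FkP => i; rewrite !valE eqxx /= hE.
  move=> j ltj; apply/negP => /FkP/(_ i0).
  by rewrite !valE eqxx /= hE; lia.
by rewrite wE; split=> //; exists i0.
Qed.

(** Legs do not interact: each is compared only with the header, which stays fixed. *)
Lemma whirl_legs f (s : seq 'I_n) : uniq s -> f \in Fk n k ->
  let g := foldl (fun g i => whirl_at (leg i) g) f s in
  [/\ g \in Fk n k, g hat0 = f hat0
    & forall i, g (leg i) =
        (if i \in s then if f (leg i) < f hat0 then (f (leg i)).+1 else 0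
         else f (leg i)) :> nat].
Proof.
elim: s f => [|i s IHs] f //= /andP[s'i uniq_s] Ff.
have [wi wother] := whirl_at_leg f i Ff.
have [Fg g0 gE] := IHs _ uniq_s (whirl_at_in_Fk (leg i) f Ff).
split=> //; first by rewrite g0 wother.
move=> j; rewrite gE inE; case: (eqVneq j i) => [->|neq_ji].
  by rewrite (negPf s'i) wi.
by rewrite !wother //; apply: contraNneq neq_ji => -[->].
Qed.

Lemma whirlP f : 0 < n -> f \in Fk n k ->
  [/\ forall i, whirl f (leg i) =
        (if f (leg i) < f hat0 then (f (leg i)).+1 else 0) :> nat,
      f hat0 < k -> whirl f hat0 = (f hat0).+1 :> nat
    & k <= f hat0 -> is_max (fun i => val (whirl f (leg i))) (whirl f hat0)].
Proof.
move=> n_gt0 Ff; rewrite /whirl.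
have [] := @whirl_legs f _ (enum_uniq 'I_n) Ff.
set g := foldl _ _ _ => Fg g0 gE.
have [wleg wlt wge] := whirl_at_hat0 _ n_gt0 Fg.
rewrite -g0; split=> // [i|/wge[le_m [i eq_i]]].
  by rewrite wleg gE mem_enum g0.
by split=> [j|]; [rewrite wleg|exists i; rewrite wleg].
Qed.

End WhirlAt.

(** * The marker argument for integer sequences *)

Section LegDynamics.

Variables (I : Type) (k : nat) (v : nat -> I -> nat) (h : nat -> nat).
Hypothesis vS : forall t i, v t.+1 i = if v t i < h t then (v t i).+1 else 0.
Hypothesis hS : forall t, h t < k -> h t.+1 = (h t).+1.
Hypothesis hmax : forall t, k <= h t -> is_max (v t.+1) (h t.+1).
Hypothesis h_le : forall t, h t <= k.

Variables (a s : I -> nat).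
Hypothesis v0 : forall i, v 0 i = a i.
Hypothesis v0_le : forall i, a i <= h 0.
Hypothesis a_max : exists i, forall j, a j <= a i.
Hypothesis s_in : forall i, exists j, s i = a j.
Hypothesis s_onto : forall j, exists i, s i = a j.
(* The second branch is the case of the largest value, where s wraps. *)
Hypothesis s_succ : forall i,
  if a i < s i then forall j, a i < a j -> s i <= a j
  else forall j, a j <= a i /\ s i <= a j.

(* At time t the marker of the header sits at x (x <= k.+1). *)
Definition marked_top (x t : nat) :=
  if x <= k then h t = x else is_max (v t) (h t).

Lemma marked_top_step x t : x <= k ->
  marked_top x t -> marked_top x.+1 t.+1.
Proof.
rewrite /marked_top => lexk; rewrite lexk => htx.
case: ifP => [ltxk|/negbT gexk]; first by rewrite hS; lia.
by apply: hmax; lia.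
Qed.

Section Marker.

Variable p : nat.
Hypothesis a_lt_p : forall i, a i < p.
Hypothesis p_le : p <= k.+1.
Hypothesis h0 : marked_top p 0.

(* The next point of the circle after [a i], the marker included. *)
Let up i := if a i < s i then s i else p.

(* In the rotating frame. First alternative: the marker is at q, the points above
   q have wrapped, and the legs at or above q have moved up by one point. Second
   alternative: all points have wrapped, the marker is at p again, and the largest
   legs, having crossed p as well, are at the smallest point. *)
Definition state_inv t :=
  (exists q, [/\ q = p \/ exists j, q = a j, q + t <= k.+1,
     forall i, if a i < q then v t i = a i + t else k.+2 + v t i = up i + t
     & marked_top (q + t) t])
  \/ (exists m, [/\ forall j, m <= a j, k.+2 <= m + t,
     forall i, k.+2 + v t i = s i + t & marked_top (p + t - k.+2) t]).

Lemma up_le i : up i <= k.+1.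
Proof.
rewrite /up; case: ifP => // _; have [j ->] := s_in i.
by have := a_lt_p j; lia.
Qed.

(** Finds the point with which a marker at [q] exchanges places: the largest leg if [q = p],
    otherwise a preimage of [q] under [s]. If [s] wraps at that preimage, [q] is the smallest leg
    value. *)
Lemma marker_pred q : (q = p \/ exists j, q = a j) ->
  (exists2 i, a i < q & up i = q /\ forall j, a j < q -> a j <= a i) \/
  (forall j, q <= a j).
Proof.
case=> [->|[j ->]].
  have [i max_i] := a_max; left; exists i => //; split=> //.
  rewrite /up; case: ifP => // lt_is; have [j eq_j] := s_in i.
  by have := max_i j; lia.
have [i eq_i] := s_onto j; have := s_succ i; case: ifP => [lt_is si|_ si].
  left; exists i; first by lia.
  split; first by rewrite /up lt_is.
  by move=> l ltl; have := si l; lia.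
by right=> l; rewrite -eq_i; case: (si l).
Qed.

Lemma state_inv0 : state_inv 0.
Proof.
left; exists p; split; rewrite ?addn0 //; first by left.
by move=> i; rewrite a_lt_p v0 addn0.
Qed.

Lemma state_invS t : t < k.+2 -> state_inv t -> state_inv t.+1.
Proof.
move=> ltt [[q [qpt qt vt ht]]|[m [min_m mt vt ht]]]; last first.
  right; exists m; split=> // [|i|].
  - by lia.
  (* Values of [s] are leg values, hence below [p], so every leg is below the header and moves
     up. *)
  - have [j sj] := s_in i; have := a_lt_p j; have := vt i; rewrite vS.
    have := ht; rewrite /marked_top ifT; last by lia.
    by move=> ->; case: ifP; lia.
  have [le1|lt1] := leqP k.+2 (p + t).
    have -> : p + t.+1 - k.+2 = (p + t - k.+2).+1 by lia.
    by apply: marked_top_step => //; lia.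
  by have [i _] := a_max; have := min_m i; have := a_lt_p i; lia.
case: (leqP (q + t) k) => [leqt|ltqt].
  (* The header is at [q + t], above all legs, so nothing wraps. *)
  left; exists q; split=> //; first by lia.
    move=> i; have := vt i; rewrite vS; have := ht; rewrite /marked_top leqt.
    by have := up_le i; move=> + ->; case: ifP => ?; case: ifP; lia.
  by rewrite addnS; apply: marked_top_step.
(* The marker is about to wrap, and the header holds the largest leg value. *)
have {qt} eqt : q + t = k.+1 by lia.
move: ht; rewrite /marked_top leqNgt ltqt /= => -[le_h [ih eq_h]].
have [[i lt_iq [up_i pred_i]]|min_q] := marker_pred _ qpt.
  have hE : h t = a i + t.
    apply/eqP; rewrite eqn_leq; apply/andP; split.
      rewrite -eq_h; have := vt ih; case: ifP => [/pred_i|_]; first by lia.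
      by have := up_le ih; lia.
    by have := le_h i; have := vt i; rewrite lt_iq; lia.
  left; exists (a i); split=> //; first by right; exists i.
  - by lia.
  - move=> j; have := vt j; have := pred_i j; have := up_le j; rewrite vS hE.
    have [lt_ji|le_ij] := ltnP (a j) (a i); first by case: ifP; case: ifP; lia.
    case: ifP => [lt_jq _ /(_ isT) le_ji ->|_]; last by case: ifP; lia.
    rewrite ifF; last by lia.
    have eq_ij : a i = a j by lia.
    (* [s] is not assumed to depend only on the value of [a]; legs with equal values share a
       successor by [s_succ]. *)
    suff : up j = up i by lia.
    have := s_succ j; have := s_succ i; rewrite /up -eq_ij.
    have [j1 sj] := s_in j; have [i1 si] := s_in i.
    case: ifP => lti; case: ifP => ltj // H1 H2.
    + by have := H1 j1; have := H2 i1; lia.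
    + by have := H2 i1; lia.
    by have := H1 j1; lia.
  rewrite addnS; apply: marked_top_step; first by have := h_le t; lia.
  by rewrite /marked_top ifT //; have := h_le t; lia.
(* All legs have wrapped, so the largest are those with [up j = p]; they return to 0 and the second
   alternative begins. *)
have {}vt j : k.+2 + v t j = up j + t.
  by have := vt j; rewrite ltnNge min_q.
have up_lep j : up j <= p.
  rewrite /up; case: ifP => // _; have [l ->] := s_in j.
  by have := a_lt_p l; lia.
have [i max_i] := a_max.
have top j : ~~ (a j < s j) -> s j = q.
  move=> nlt; have := s_succ j; rewrite (negPf nlt) => H.
  have [l sl] := s_in j; have := min_q l.
  case: qpt => [eq_qp|[l' eq_q]]; first by have := min_q i; have := a_lt_p i; lia.
  by have := (H l').2; lia.
have hE : k.+2 + h t = p + t.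
  have upi : up i = p.
    rewrite /up; case: ifP => //; have [l ->] := s_in i.
    by have := max_i l; lia.
  by have := vt i; have := vt ih; have := up_lep ih; have := le_h i; lia.
right; exists q; split=> //; first by lia.
  move=> j; have := vt j; have := top j; rewrite vS /up.
  have [l sl] := s_in j; have := a_lt_p l.
  by case: (a j < s j) => /=; [|move=> _ /(_ isT)]; case: ifP; lia.
have -> : p + t.+1 - k.+2 = (p + t - k.+2).+1 by lia.
apply: marked_top_step; first by have := h_le t; lia.
by rewrite /marked_top ifT; have := h_le t; lia.
Qed.

Lemma state_inv_end : (forall i, v k.+2 i = s i) /\ marked_top p k.+2.
Proof.
have : state_inv k.+2.
  suff H t : t <= k.+2 -> state_inv t by apply: H.
  elim: t => [|t IHt] ltt; first exact: state_inv0.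
  by apply: state_invS => //; apply/IHt/ltnW.
case=> [[q []]|[m [_ _ vt]]]; first by lia.
by rewrite addnK; split=> // i; have := vt i; lia.
Qed.

End Marker.

(** The marker starts at [h 0], or at [k.+1] if some leg equals the header. In the latter case the
    final header is the largest value of [s], which is that of [a], since both take the same
    values. *)
Lemma dynamics_end : (forall i, v k.+2 i = s i) /\ h k.+2 = h 0.
Proof.
have [i max_i] := a_max.
have [lt_ih|ge_ih] := ltnP (a i) (h 0).
  have [] := @state_inv_end (h 0).
  - by move=> j; have := max_i j; lia.
  - by have := h_le 0; lia.
  - by rewrite /marked_top h_le.
  by rewrite /marked_top h_le.
have [] := @state_inv_end k.+1 => //.
- by move=> j; have := max_i j; have := v0_le i; have := h_le 0; lia.
- rewrite /marked_top ltnn; split=> [j|]; first by rewrite v0.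
  by exists i; rewrite v0; have := v0_le i; lia.
rewrite /marked_top ltnn => vE [le_h [j eq_h]]; split=> //.
have [l sl] := s_in j; have [i' si] := s_onto i.
by have := le_h i'; have := v0_le l; rewrite -eq_h !vE; lia.
Qed.

End LegDynamics.

(** * Cyclic successors and the orbit of whirling *)

Section Orbit.

Variables n k : nat.
Implicit Types (f : labeling n k) (A : {set 'I_k.+1}).

Lemma cyc_succ_image A : [set cyc_succ A a | a in A] = A.
Proof.
apply/eqP; rewrite eqEcard; apply/andP; split.
  by apply/subsetP => _ /imsetP[a Aa ->]; apply: cyc_succ_in.
rewrite card_imset //; apply: can_inj (prev_next _).
exact: enum_uniq.
Qed.

Lemma Aset_wbar f : Aset (wbar (Aset f) f) = Aset f.
Proof.
rewrite -[RHS]cyc_succ_image -imset_comp.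
by apply: eq_imset => j; rewrite ffunE.
Qed.

(** [next] runs through [enum A] as a single cycle, so every point has order [#|A|]. *)
Lemma iter_cyc_succ A a : a \in A -> iter #|A| (cyc_succ A) a = a.
Proof.
rewrite -(mem_enum A) cardE => Aa.
have cycA := cycle_next (enum_uniq A).
by rewrite -(order_cycle cycA (enum_uniq A) Aa) (iter_order_cycle cycA).
Qed.

Lemma iter_wbar m A f y : iter m (wbar A) f y =
  if y is Some j then iter m (cyc_succ A) (f (leg j)) else f hat0.
Proof.
by elim: m y => [|m IHm] [j|] //=; rewrite ffunE IHm.
Qed.

Lemma iter_whirl_wbar f : 0 < n -> f \in Fk n k ->
  iter (k + 2) (@whirl n k) f = wbar (Aset f) f.
Proof.
move=> n_gt0 Ff; have Ft t : iter t (@whirl n k) f \in Fk n k.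
  by elim: t => //= t; apply: whirl_Fk.
have a_in i : f (leg i) \in Aset f by apply: imset_f.
rewrite addn2.
have [] := @dynamics_end 'I_n k
  (fun t i => val (iter t (@whirl n k) f (leg i)))
  (fun t => val (iter t (@whirl n k) f hat0)) _ _ _ _
  (fun i => val (f (leg i))) (fun i => val (cyc_succ (Aset f) (f (leg i)))) => //.
- by move=> t i /=; have [] := whirlP _ _ _ n_gt0 (Ft t).
- by move=> t /=; have [] := whirlP _ _ _ n_gt0 (Ft t).
- by move=> t /=; have [] := whirlP _ _ _ n_gt0 (Ft t).
- by move=> t; apply: (ltn_ord (iter t _ f hat0)).
- exact/FkP.
- exists [arg max_(i > Ordinal n_gt0) val (f (leg i))] => j.
  by case: arg_maxnP => //= i _; apply.
- move=> i; by have /imsetP[j _ ->] := cyc_succ_in (a_in i); exists j.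
- move=> j; have : f (leg j) \in [set cyc_succ (Aset f) a | a in Aset f].
    by rewrite cyc_succ_image.
  by case/imsetP=> _ /imsetP[i _ ->] ->; exists i.
- move=> i; have := cyc_succP (a_in i).
  case: ifP => [_ [lt_s s_le]|/negbT nex s_le].
    by rewrite lt_s => j; apply: s_le.
  have max_i j : f (leg j) <= f (leg i).
    rewrite leqNgt; apply: contraNN nex => lt_ij.
    by apply/existsP; exists (f (leg j)); rewrite a_in.
  rewrite ifF; first by move=> j; split; [exact: max_i|apply: s_le].
  by apply: negbTE; rewrite -leqNgt; apply: s_le.
move=> vE hE; apply/ffunP => -[i|]; apply: val_inj; rewrite ffunE.
- exact: vE.
- exact: hE.
Qed.

End Orbit.

Theorem theorem4p8 (n k : nat) (hn : 1 <= n) (hk : 1 <= k)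
    (f : labeling n k) (hf : f \in Fk n k) :
  iter (k + 2) (@whirl n k) f = wbar (Aset f) f /\
  iter (#|Aset f| * (k + 2)) (@whirl n k) f = f.
Proof.
split; first exact: iter_whirl_wbar.
(* The invariance of [Aset] is carried along so that every round uses the successor in the same
   set. *)
have iterE m : iter (m * (k + 2)) (@whirl n k) f = iter m (wbar (Aset f)) f /\
    Aset (iter m (wbar (Aset f)) f) = Aset f.
  elim: m => [|m [IHm IHA]] //.
  have Fm : iter m (wbar (Aset f)) f \in Fk n k.
    by rewrite -IHm; elim: (m * _) => //= t; apply: whirl_Fk.
  split; last by rewrite iterS -{1}IHA Aset_wbar.
  by rewrite mulSn iterD IHm iter_whirl_wbar // IHA.
rewrite (iterE _).1; apply/ffunP => y; rewrite iter_wbar.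
by case: y => [j|] //; rewrite iter_cyc_succ //; apply: imset_f.
Qed.
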